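(* Let $G$ be an $n$-vertex simple graph with $n\ge 7$. If $G$ has no matching of size $3$ and $\delta(G)\ge 2$, then $G$ is isomorphic to the book graph $B_{n-2}$ or to $B_{n-2}^-$.
   Context: For a positive integer $t$, the book graph $B_t$ is the graph obtained from $t$ triangles sharing one common edge (so it has $t+2$ vertices). $B_t^-$ is obtained from $B_t$ by deleting the common edge. $\delta(G)$ is the minimum degree. *)

(* Defs.v *)
From mathcomp Require Import all_boot.
Set Implicit Arguments.
Unset Strict Implicit.
Unset Printing Implicit Defensive.

Record sgraph := SGraph {
  vertex :> finType;
  adj : rel vertex;
  adj_sym : symmetric adj;
  adj_irr : irreflexive adj }.

Definition edges (G : sgraph) : {set {set G}} :=
  [set [set p.1; p.2] | p in [pred p : G * G | adj p.1 p.2]].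

(* Edges are nonempty, so trivIset says exactly that distinct members of M
   share no vertex. *)
Definition matching (G : sgraph) (M : {set {set G}}) : bool :=
  (M \subset edges G) && trivIset M.

Definition degree (G : sgraph) (x : G) : nat := #|[set y | adj x y]|.

(* Every degree is below #|G|, so the neutral element #|G| does not affect the
   minimum of a nonempty graph. *)
Definition min_degree (G : sgraph) : nat := \big[minn/#|G|]_(x : G) degree x.

Definition isomorphic (G H : sgraph) : Prop :=
  exists2 f : G -> H, bijective f & forall x y, adj (f x) (f y) = adj x y.

Section DeleteEdge.
Variables (G : sgraph) (u v : G).

Definition del_edge_rel : rel G :=
  fun x y => adj x y && ([set x; y] != [set u; v]).

Fact del_edge_sym : symmetric del_edge_rel.
Proof. by move=> x y; rewrite /del_edge_rel adj_sym setUC. Qed.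

Fact del_edge_irr : irreflexive del_edge_rel.
Proof. by move=> x; rewrite /del_edge_rel adj_irr. Qed.

Definition del_edge : sgraph := SGraph del_edge_sym del_edge_irr.
End DeleteEdge.

Section Book.
Variable t : nat.

(* [inl false] and [inl true] are the ends of the common edge; [inr i] is the
   third vertex of the i-th triangle. *)
Definition book_vertex : finType := (bool + 'I_t)%type.

Definition book_triangle (i : 'I_t) : {set book_vertex} :=
  [set inl false; inl true; inr i].

Definition book_rel : rel book_vertex := fun x y =>
  (x != y) && [exists i, (x \in book_triangle i) && (y \in book_triangle i)].

Fact book_sym : symmetric book_rel.
Proof.
move=> x y; rewrite /book_rel eq_sym; congr (_ && _).
by apply: eq_existsb => i; rewrite andbC.
Qed.

Fact book_irr : irreflexive book_rel.
Proof. by move=> x; rewrite /book_rel eqxx. Qed.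

Definition book : sgraph := SGraph book_sym book_irr.

Definition book_minus : sgraph :=
  @del_edge book (inl false) (inl true).
End Book.

(* Main.v *)
(** Fix a matching [ab], [cd] and let [W] be the set of the other vertices,
    which is independent.  If [w ~ a] and [w' ~ b] with [w], [w'] in [W], then
    [w = w'], since otherwise [wa], [w'b], [cd] is a matching; but then all
    other vertices of [W] are adjacent to exactly [c] and [d], and two of them
    give a matching of size 3 with [ab].  So one end of each edge, say [b] and
    [d], has no neighbour in [W]; hence [W] is completely joined to [a] and [c],
    and [b ~ d] is excluded by the matching [wa], [w'c], [bd].  Thus every edge
    meets [{a, c}], and the minimum degree determines [G] up to [ac]. *)
Require Import Defs.
From mathcomp Require Import all_boot.
Set Implicit Arguments.
Unset Strict Implicit.
Unset Printing Implicit Defensive.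

(** * Automation for distinctness of vertices *)

Ltac split_neqs := repeat match goal with
  | H : is_true (uniq _) |- _ => move: H; rewrite /= ?inE ?negb_or => H
  | H : is_true (_ \notin _) |- _ => move: H; rewrite /= ?inE ?negb_or => H
  | H : is_true (_ && _) |- _ => case/andP: H => ? ?
  end.

Ltac uniq_from_neqs :=
  split_neqs; rewrite /= ?inE ?negb_or; repeat (apply/andP; split);
  first [done | by rewrite eq_sym].

(** * Vertices outside a list, and consequences of minimum degree 2 *)

Lemma ex_notin_seq (T : finType) (s : seq T) :
  size s < #|T| -> exists x, x \notin s.
Proof.
move=> lt_s; apply/existsP; apply: contraLR lt_s => /existsPn all_s.
rewrite -leqNgt; apply: leq_trans (card_size s).
by apply/subset_leq_card/subsetP => x _; apply/negPn/all_s.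
Qed.

Lemma min_degree_le (G : sgraph) (x : G) : min_degree G <= degree x.
Proof.
rewrite /min_degree; have := mem_index_enum x.
elim: (index_enum _) => // y r IHr; rewrite inE big_cons geq_min.
by case/orP => [/eqP -> | /IHr ->]; rewrite ?leqnn ?orbT.
Qed.

Lemma adj_neq (G : sgraph) (x y : G) : adj x y -> x != y.
Proof. by apply: contraTneq => ->; rewrite adj_irr. Qed.

Lemma ex_adj_neq (G : sgraph) (x y : G) :
  2 <= min_degree G -> exists2 z, adj x z & z != y.
Proof.
move=> /leq_trans /(_ (min_degree_le x)); rewrite /degree.
rewrite (cardsD1 y) => lt1.
have /card_gt0P [z] : 0 < #|[set z | adj x z] :\ y|.
  by case: (y \in _) lt1 => // /ltnW.
by rewrite !inE => /andP [nzy xz]; exists z.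
Qed.

(** A neighbour other than [a] can only be [b], and a neighbour other than [b] can only be [a]. *)
Lemma adj_pair (G : sgraph) (x a b : G) : 2 <= min_degree G ->
  (forall z, adj x z -> z \in [:: a; b]) -> adj x a /\ adj x b.
Proof.
move=> hdeg nbr.
have [z xz nza] := ex_adj_neq x a hdeg; have [y xy nyb] := ex_adj_neq x b hdeg.
move: (nbr _ xz) (nbr _ xy); rewrite !inE (negPf nza) (negPf nyb) orbF /=.
by move=> /eqP <- /eqP <-.
Qed.

(** * Matchings of size 3 as six distinct vertices *)

Definition three_matching_free (G : sgraph) : Prop :=
  forall a b c d e f : G, adj a b -> adj c d -> adj e f ->
    ~ uniq [:: a; b; c; d; e; f].

Lemma three_matching_freeI (G : sgraph) :
  ~ (exists M : {set {set G}}, matching M /\ #|M| = 3) ->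
  three_matching_free G.
Proof.
move=> noM a b c d e f ab cd ef us; apply: noM.
have edge x y : adj x y -> [set x; y] \in edges G.
  by move=> xy; apply/imsetP; exists (x, y).
have disj x y z t : uniq [:: x; y; z; t] -> [disjoint [set x; y] & [set z; t]].
  move=> u; apply/pred0P => w /=; apply/negbTE/negP; rewrite !inE.
  by case/andP=> /orP [] /eqP -> /orP [] /eqP eq_xy; move: u;
    rewrite eq_xy /= !inE eqxx ?orbT ?andbF.
(* Disjoint nonempty sets differ; hence the set of the three edges has cardinality exactly 3. *)
have disjN x y z t : uniq [:: x; y; z; t] -> [set x; y] != [set z; t].
  move=> /disj; apply: contraTneq => ->.
  by rewrite -setI_eq0 setIid; apply/set0Pn; exists z; rewrite !inE eqxx.
have dac : uniq [:: a; b; c; d] by uniq_from_neqs.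
have dae : uniq [:: a; b; e; f] by uniq_from_neqs.
have dce : uniq [:: c; d; e; f] by uniq_from_neqs.
exists [set [set a; b]; [set c; d]; [set e; f]]; split; last first.
  by rewrite -setUA cardsU1 cards2 !inE negb_or !disjN.
apply/andP; split.
  by apply/subsetP => X; rewrite !inE => /orP [/orP [] |] /eqP ->; apply: edge.
apply/trivIsetP => X Y.
rewrite !inE => /orP [/orP [] |] /eqP -> /orP [/orP [] |] /eqP ->;
  rewrite ?eqxx // => _; first [exact: disj | by rewrite disjoint_sym disj].
Qed.

(** * Two vertices that meet every edge *)

Section VertexCover.
Variable G : sgraph.
Hypotheses (hG : 7 <= #|G|) (hdeg : 2 <= min_degree G).
Hypothesis no3 : three_matching_free G.

(** If every edge meets a given edge [xy], each other vertex has both [x] and [y] as neighbours, so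
    two other vertices [p], [q] give the disjoint edges [px] and [qy]. *)
Lemma ex_two_matching :
  exists a b c d : G, [/\ adj a b, adj c d & uniq [:: a; b; c; d]].
Proof.
have [|x _] := @ex_notin_seq G [::]; first exact: leq_trans hG.
have [y xy _] := ex_adj_neq x x hdeg; have nxy := adj_neq xy.
have [|p pxy] := @ex_notin_seq G [:: x; y]; first exact: leq_trans hG.
have [|q qxyp] := @ex_notin_seq G [:: x; y; p]; first exact: leq_trans hG.
have [/existsP [r /existsP [s /and3P [rs rxy sxy]]] | noE] :=
  boolP [exists r, exists s, [&& adj r s, r \notin [:: x; y]
                                        & s \notin [:: x; y]]].
  by have := adj_neq rs; exists x, y, r, s; split=> //; uniq_from_neqs.
have joined r : r \notin [:: x; y] -> adj r x /\ adj r y.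
  move=> rxy; apply: adj_pair => // s rs; apply: contraNT noE => sxy.
  by apply/existsP; exists r; apply/existsP; exists s; rewrite rs rxy.
have [px _] := joined p pxy.
have [|_ qy] := joined q; first by uniq_from_neqs.
by exists p, x, q, y; split=> //; uniq_from_neqs.
Qed.

Lemma matching_end_free (a b c d : G) :
  adj a b -> adj c d -> uniq [:: a; b; c; d] ->
  (forall w, w \notin [:: a; b; c; d] -> ~~ adj w b) \/
  (forall w, w \notin [:: a; b; c; d] -> ~~ adj w a).
Proof.
move=> ab cd us.
have [/existsP [w /andP [wW wb]] | nob] :=
  boolP [exists w, (w \notin [:: a; b; c; d]) && adj w b]; last first.
  left=> w wW; apply: contraNN nob => wb.
  by apply/existsP; exists w; rewrite wW.
right=> w' w'W; apply/negP => w'a.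
have eq_w : w' = w.
  apply/eqP; apply/negPn/negP => nw.
  by apply: (no3 w'a wb cd); uniq_from_neqs.
have wa : adj w a by rewrite -eq_w.
(* Since [w] sees both [a] and [b], an edge [pa] extends to the matching [pa], [wb], [cd], and [pb]
   to [pb], [wa], [cd]; an edge from [p] to a vertex outside [a], [b], [c], [d] is disjoint from
   [ab] and [cd]. *)
have joined p : p \notin [:: a; b; c; d; w] -> adj p c /\ adj p d.
  move=> pW; apply: adj_pair => // z pz; apply/negPn/negP => zcd.
  have npz := adj_neq pz.
  have [eza | nza] := eqVneq z a.
    by rewrite {z}eza in pz zcd npz *; apply: (no3 pz wb cd); uniq_from_neqs.
  have [ezb | nzb] := eqVneq z b.
    by rewrite {z}ezb in pz zcd npz nza *; apply: (no3 pz wa cd); uniq_from_neqs.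
  by apply: (no3 ab cd pz); uniq_from_neqs.
have [|p pW] := @ex_notin_seq G [:: a; b; c; d; w]; first exact: leq_trans hG.
(* [q] is the seventh vertex: here the bound [7 <= #|G|] is used in full. *)
have [|q qW] := @ex_notin_seq G [:: a; b; c; d; w; p]; first exact: leq_trans hG.
have [pc _] := joined p pW.
have [|_ qd] := joined q; first by uniq_from_neqs.
by apply: (no3 ab pc qd); uniq_from_neqs.
Qed.

Lemma cover_of_free_ends (a b c d : G) :
  adj a b -> adj c d -> uniq [:: a; b; c; d] ->
  (forall w, w \notin [:: a; b; c; d] -> ~~ adj w b) ->
  (forall w, w \notin [:: a; b; c; d] -> ~~ adj w d) ->
  forall x y, adj x y -> x \notin [:: a; c] -> y \in [:: a; c].
Proof.
move=> ab cd us freeb freed.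
have joined w : w \notin [:: a; b; c; d] -> adj w a /\ adj w c.
  move=> wW; apply: adj_pair => // z wz; apply/negPn/negP => zac.
  have nwz := adj_neq wz.
  have nzb : z != b by apply: contraTneq wz => ->; apply: freeb.
  have nzd : z != d by apply: contraTneq wz => ->; apply: freed.
  by apply: (no3 ab cd wz); uniq_from_neqs.
have nbd : ~~ adj b d.
  apply/negP => bd.
  have [|p pW] := @ex_notin_seq G [:: a; b; c; d]; first exact: leq_trans hG.
  have [|q qW] := @ex_notin_seq G [:: a; b; c; d; p]; first exact: leq_trans hG.
  have [pa _] := joined p pW.
  have [|_ qc] := joined q; first by uniq_from_neqs.
  by apply: (no3 pa qc bd); uniq_from_neqs.
have ends z : z \notin [:: a; c] ->
    [\/ z = b, z = d | z \notin [:: a; b; c; d]].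
  move=> zac; have [-> | nzb] := eqVneq z b; first by constructor 1.
  have [-> | nzd] := eqVneq z d; first by constructor 2.
  by constructor 3; uniq_from_neqs.
(* An edge avoiding [a] and [c] has each end equal to [b] or [d] or off the matching. Irreflexivity,
   [nbd], [freeb] and [freed] leave only two ends off the matching, where [xy] joins [ab] and [cd]
   in a matching. *)
move=> x y xy xac; apply/negPn/negP => yac; move: xy.
case: (ends _ xac) => [-> | -> | xW]; case: (ends _ yac) => [-> | -> | yW];
  rewrite ?adj_irr //; try by [apply/negP | apply/negP; rewrite adj_sym; auto].
- exact/negP/freeb.
- exact/negP/freed.
- by move=> xy; have := adj_neq xy => nxy; apply: (no3 ab cd xy); uniq_from_neqs.
Qed.

Lemma ex_cover :
  exists u v : G, u != v /\
    forall x y, adj x y -> x \notin [:: u; v] -> y \in [:: u; v].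
Proof.
have [a [b [c [d [ab cd us]]]]] := ex_two_matching.
have [ba dc] : adj b a /\ adj d c by split; rewrite adj_sym.
have ucd : uniq [:: c; d; a; b] by uniq_from_neqs.
(* Either end of each edge may be the free one; reversing edges brings all four cases to this
   form. *)
have cover (a' b' c' d' : G) : adj a' b' -> adj c' d' -> uniq [:: a'; b'; c'; d'] ->
    (forall w, w \notin [:: a'; b'; c'; d'] -> ~~ adj w b' /\ ~~ adj w d') ->
  exists u v : G, u != v /\
    forall x y, adj x y -> x \notin [:: u; v] -> y \in [:: u; v].
  move=> ab' cd' us' free; exists a', c'; split; first by uniq_from_neqs.
  by apply: (cover_of_free_ends ab' cd' us') => w /free [].
case: (matching_end_free ab cd us) => freeab;
  case: (matching_end_free cd ab ucd) => freecd;
  [apply: (cover a b c d) | apply: (cover a b d c)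
  | apply: (cover b a c d) | apply: (cover b a d c)];
  first [done | by uniq_from_neqs | move=> w wW];
  by split; [apply: freeab | apply: freecd]; uniq_from_neqs.
Qed.

End VertexCover.

(** * Adjacency in the two book graphs *)

Lemma book_adjE t (x y : book t) : 0 < t ->
  adj x y = match x, y with
            | inl b, inl b' => b != b'
            | inr _, inr _ => false
            | _, _ => true
            end.
Proof.
move=> t_gt0; rewrite /= /book_rel.
case: x y => [b | i] [b' | j].
- rewrite (inj_eq inl_inj); case: eqP => //= _.
  (* The ends of the common edge are adjacent only through some triangle; [0 < t] supplies the first
     one. *)
  apply/existsP; exists (Ordinal t_gt0); rewrite !inE !(inj_eq inl_inj).
  by case: b b' => [] [].
- by apply/existsP; exists j; rewrite !inE !(inj_eq inl_inj) eqxx orbT; case: b.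
- by apply/existsP; exists i; rewrite !inE !(inj_eq inl_inj) eqxx orbT; case: b'.
- apply/negP => /andP [nij /existsP [k]]; rewrite !inE /= => /andP [/eqP ik /eqP jk].
  by rewrite ik jk eqxx in nij.
Qed.

Lemma book_minus_adjE t (x y : book_minus t) : 0 < t ->
  adj x y = match x, y with
            | inl _, inl _ | inr _, inr _ => false
            | _, _ => true
            end.
Proof.
move=> t_gt0; rewrite /= /del_edge_rel book_adjE //.
(* Deleting the common edge leaves the pairs through [inr i] untouched, as [inr i] is not one of its
   ends. *)
have edgeN (p q : book_vertex t) i : (p == inr i) || (q == inr i) ->
    [set p; q] != [set inl false; inl true].
  move=> pq; apply/eqP => /setP /(_ (inr i)); rewrite !inE eq_sym.
  by rewrite [inr i == q]eq_sym pq.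
case: x y => [b | i] [b' | j] //=.
- by case: b b' => [] [] //=; rewrite ?eqxx // setUC eqxx.
- by apply: (edgeN _ _ j); rewrite eqxx orbT.
- by apply: (edgeN _ _ i); rewrite eqxx.
Qed.

(** * From the two covering vertices to a book graph *)

Section CoverIsomorphism.
Variables (G : sgraph) (u v : G).
Hypothesis neq_uv : u != v.

Lemma ex_book_bijection : exists g : book_vertex (#|G| - 2) -> G,
  [/\ bijective g, g (inl false) = u, g (inl true) = v
    & forall i, g (inr i) \notin [:: u; v]].
Proof.
pose s := enum [pred x | x \notin [:: u; v]].
have size_s : size s = #|G| - 2.
  rewrite -cardE; have := cardC (mem [:: u; v]); rewrite (card_uniqP _) /=.
    by move=> <-; rewrite addKn; apply: eq_card.
  by rewrite !inE neq_uv.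
have s_in (i : 'I_(#|G| - 2)) : nth u s i \notin [:: u; v].
  have : nth u s i \in s by rewrite mem_nth ?size_s.
  by rewrite mem_enum inE.
pose g p := match p : book_vertex (#|G| - 2) with
            | inl b => if b then v else u
            | inr i => nth u s i
            end.
exists g; split=> //; apply: inj_card_bij.
  have neq_g b i : g (inl b) <> g (inr i).
    by move=> /= e; move: (s_in i); rewrite -e !inE; case: b {e}; rewrite eqxx ?orbT.
  move=> [b | i] [b' | j] //.
  - by case: b b' => [] [] //= e; move: neq_uv; rewrite e eqxx.
  - by move=> /neq_g.
  - by move=> /esym /neq_g.
  - move=> /= /eqP; rewrite nth_uniq ?size_s ?enum_uniq // => /eqP ij.
    by rewrite (val_inj ij).
(* The distinct [u], [v] give [2 <= #|G|], so the truncated difference satisfies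
   [2 + (#|G| - 2) = #|G|], and injectivity of [g] suffices. *)
have := max_card (mem [:: u; v]); rewrite (card_uniqP _) /=; last first.
  by rewrite !inE neq_uv.
by move=> le2; rewrite card_sum card_bool card_ord subnKC.
Qed.

Lemma isomorphic_of_cover : 2 < #|G| -> 2 <= min_degree G ->
  (forall x y, adj x y -> x \notin [:: u; v] -> y \in [:: u; v]) ->
  isomorphic G (book (#|G| - 2)) \/ isomorphic G (book_minus (#|G| - 2)).
Proof.
move=> hG hdeg cover.
have t_gt0 : 0 < #|G| - 2 by rewrite subn_gt0.
have joined x : x \notin [:: u; v] -> adj x u /\ adj x v.
  by move=> xuv; apply: adj_pair => // y xy; apply: cover xy xuv.
have [g [[f fK gK] g0 g1 gi]] := ex_book_bijection.
have f_bij : bijective f by exists g.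
(* Transported along [g], every adjacency is fixed except [adj u v], which decides between the two
   graphs. *)
have adj_gE p q : adj (g p) (g q) =
    match p, q with
    | inl b, inl b' => adj u v && (b != b')
    | inr _, inr _ => false
    | _, _ => true
    end.
  case: p q => [b | i] [b' | j].
  - by case: b b' => [] []; rewrite ?g0 ?g1 ?adj_irr ?andbF ?andbT // adj_sym.
  - by have [? ?] := joined _ (gi j); rewrite adj_sym; case: b; rewrite ?g0 ?g1.
  - by have [? ?] := joined _ (gi i); case: b'; rewrite ?g0 ?g1.
  - by apply/negP => /cover /(_ (gi i)); apply/negP/gi.
have [uv | nuv] := boolP (adj u v); [left | right];
  exists f => // x y; rewrite -{2}[x]gK -{2}[y]gK adj_gE.
- by rewrite book_adjE // uv.
- by rewrite book_minus_adjE // (negPf nuv).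
Qed.

End CoverIsomorphism.

Theorem theorem6 (n : nat) (G : sgraph) (hG : #|G| = n) (hn : 7 <= n)
    (hM : ~ exists M : {set {set G}}, matching M /\ #|M| = 3)
    (hdeg : 2 <= min_degree G) :
  isomorphic G (book (n - 2)) \/ isomorphic G (book_minus (n - 2)).
Proof.
subst n; have [u [v [nuv cover]]] := ex_cover hn hdeg (three_matching_freeI hM).
by apply: (isomorphic_of_cover nuv) => //; apply: leq_trans hn.
Qed.
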